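(* Let $j\in\mathcal C^4(Q,\mathbb R)$ and $i\in\mathcal C^3(Q,\mathbb R)$ be the reduced cost functional and the reduced quantity of interest. Suppose $\overline q\in Q$ solves $\min_{q\in Q} j(q)$, and $\overline p\in Q$ solves the reduced adjoint problem $$ j''(\overline q)(\delta q,\overline p)=-i'(\overline q)(\delta q)\qquad\forall\,\delta q\in Q. $$ Then for arbitrary fixed $\tilde q_h\in Q$ and $\tilde p_h\in Q$, $$ i(\overline q)-i(\tilde q_h)=\tfrac12\rho(\tilde q_h)(\overline p-\tilde p_h)+\tfrac12\rho^*(\tilde q_h,\tilde p_h)(\overline q-\tilde q_h)+\rho(\tilde q_h)(\tilde p_h)+\mathcal R^{(3)}, $$ where $$ \rho(\tilde q_h)(\cdot):=j'(\tilde q_h)(\cdot),\qquad \rho^*(\tilde q_h,\tilde p_h)(\cdot):=i'(\tilde q_h)(\cdot)+j''(\tilde q_h)(\cdot,\tilde p_h), $$ and, with $e:=\overline q-\tilde q_h$ and $e^*:=\overline p-\tilde p_h$, $$ \mathcal R^{(3)}:=\frac12\int_0^1\big[i'''(\tilde q_h+se)(e,e,e)+j''''(\tilde q_h+se)(e,e,e,\tilde p_h+se^* )+3j'''(\tilde q_h+se)(e,e,e^* )\big]\,s(s-1)\,ds. $$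
   Context: $U,Q,V$ are real Banach spaces, $J:U\times Q\to\mathbb R$ is a cost functional, $A:U\times Q\to V^*$ is the (nonlinear) state operator, and $I:U\times Q\to\mathbb R$ is a quantity of interest. It is assumed that there is a unique map $S:Q\to U$ (control-to-state map) with $A(S(q),q)=0$ for all $q\in Q$, and that $S$ is twice continuously Fréchet differentiable. The reduced functionals are $j(q):=J(S(q),q)$ and $i(q):=I(S(q),q)$. Solving $\min_{q\in Q}j(q)$ is understood in the sense of being a (local) minimizer. The reduced adjoint problem is assumed to have a unique solution. Derivatives are Fréchet derivatives, and $j^{(k)}(q)(d_1,\dots,d_k)$ denotes the $k$-th derivative at $q$ as a symmetric $k$-linear form applied to $d_1,\dots,d_k\in Q$. *)

(* Defs.v *)
From HB Require Import structures.
From mathcomp Require Import all_boot all_order all_algebra.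
From mathcomp Require Import all_classical all_reals all_analysis.
Set Implicit Arguments.
Unset Strict Implicit.
Unset Printing Implicit Defensive.
Import Order.TTheory GRing.Theory Num.Theory.
Import numFieldNormedType.Exports.
Local Open Scope classical_set_scope.
Local Open Scope ring_scope.

Section BoundedLinear.
Variables (R : realType) (V W : normedModType R).

Definition blin_pred : {pred V -> W} :=
  mem [set f : V -> W | linear f /\ continuous f].

(* The space L(V, W), with the operator norm below; [blin V R] is V^* *)
Record blin := Blin { blin_fun :> V -> W; _ : blin_fun \in blin_pred }.

HB.instance Definition _ := [isSub for blin_fun].
HB.instance Definition _ := gen_eqMixin blin.
HB.instance Definition _ := gen_choiceMixin blin.

Lemma blin_submod_closed : submod_closed blin_pred.
Proof.
split=> [|a f g].
  rewrite inE; split=> [a u v|x]; first by rewrite /= scaler0 addr0.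
  exact: cst_continuous.
rewrite !inE => -[fl fc] [gl gc]; split=> [b u v|x].
  rewrite !fctE fl gl !scalerDr !scalerA [a * b]mulrC -!addrA; congr (_ + _).
  by rewrite addrCA.
by apply: cvgD; [apply: cvgZr; exact: fc|exact: gc].
Qed.

HB.instance Definition _ := GRing.isSubmodClosed.Build R (V -> W) blin_pred
  blin_submod_closed.
HB.instance Definition _ := [SubChoice_isSubLmodule of blin by <:].

Lemma blin_linear (f : blin) : linear f.
Proof. by have /set_mem[] := valP f. Qed.

Lemma blin_continuous (f : blin) : continuous f.
Proof. by have /set_mem[] := valP f. Qed.

HB.instance Definition _ (f : blin) :=
  GRing.isLinear.Build R V W *:%R f (blin_linear f).

Definition opnorm (f : blin) : R :=
  sup [set `|f x| | x in [set x : V | `|x| <= 1]].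

Lemma blin_bounded (f : blin) : exists M : R, forall x, `|f x| <= M * `|x|.
Proof.
have /linear_bounded_continuous/linear_boundedP/pinfty_ex_gt0[M _ fM] :=
  @blin_continuous f.
by exists M.
Qed.

Lemma opnorm_le (f : blin) (M : R) :
  (forall x, `|x| <= 1 -> `|f x| <= M) -> opnorm f <= M.
Proof.
move=> fM; apply: ge_sup => [|_ [x /= x1 <-]]; last exact: fM.
by exists `|f 0|, 0 => //=; rewrite normr0.
Qed.

Lemma le_opnorm1 (f : blin) (x : V) : `|x| <= 1 -> `|f x| <= opnorm f.
Proof.
move=> x1; apply: ub_le_sup; last by exists x.
have [M fM] := blin_bounded f.
exists `|M| => _ [y /= y1 <-]; rewrite (le_trans (fM y))//.
rewrite (le_trans (ler_norm _))// normrM normr_id ler_piMr//.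
Qed.

Lemma opnorm_ge0 (f : blin) : 0 <= opnorm f.
Proof. by rewrite (le_trans _ (@le_opnorm1 f 0 _))// normr0. Qed.

Lemma le_opnorm (f : blin) (x : V) : `|f x| <= opnorm f * `|x|.
Proof.
have [->|x0] := eqVneq x 0; first by rewrite linear0 !normr0 mulr0.
rewrite -ler_pdivrMr ?normr_gt0//.
suff -> : `|f x| / `|x| = `|f (`|x|^-1 *: x)|.
  by apply: le_opnorm1; rewrite normfZV.
by rewrite linearZ normrZ normfV normr_id mulrC.
Qed.

Lemma ler_opnormD (f g : blin) : opnorm (f + g) <= opnorm f + opnorm g.
Proof.
apply: opnorm_le => x x1; rewrite (le_trans (ler_normD _ _))//.
by rewrite lerD// le_opnorm1.
Qed.

Lemma opnormZ (l : R) (f : blin) : opnorm (l *: f) = `|l| * opnorm f.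
Proof.
have le_opnormZ k (g : blin) : opnorm (k *: g) <= `|k| * opnorm g.
  by apply: opnorm_le => x x1; rewrite normrZ ler_wpM2l// le_opnorm1.
apply/eqP; rewrite eq_le le_opnormZ/=.
have [->|l0] := eqVneq l 0; first by rewrite normr0 mul0r opnorm_ge0.
rewrite -ler_pdivlMl ?normr_gt0// -normfV.
by rewrite -[in leLHS](scalerK l0 f) le_opnormZ.
Qed.

Lemma opnorm_eq0 (f : blin) : opnorm f = 0 -> f = 0.
Proof.
move=> f0; apply/val_inj/funext => x /=; apply/eqP; rewrite -normr_le0.
by rewrite (le_trans (le_opnorm f x))// f0 mul0r.
Qed.

HB.instance Definition _ :=
  Lmodule_isNormed.Build R blin ler_opnormD opnormZ opnorm_eq0.

(* Only meaningful where [f] is differentiable: elsewhere ['d f x] is an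
   arbitrary linear map, replaced by 0 if it is not continuous. *)
Definition fderiv (f : V -> W) (x : V) : blin :=
  insubd (0 : blin) ('d f x : V -> W).

Lemma fderivE (f : V -> W) (x : V) :
  differentiable f x -> fderiv f x = 'd f x :> (V -> W).
Proof.
move=> df; rewrite /fderiv -[LHS]/(val _) val_insubd ifT// inE.
by split; [exact: linearP|exact: diff_continuous].
Qed.

End BoundedLinear.

Fixpoint is_Cn (R : realType) (n : nat) (V W : normedModType R) (f : V -> W)
    : Prop :=
  if n is m.+1 then (forall x, differentiable f x) /\ is_Cn m (fderiv f)
  else continuous f.

(* Higher derivatives are iterated into L(Q, L(Q, ...)): the first argument of
   [fderiv2 f q d1 d2] is the direction of the outermost derivative. For f of
   class C^k the k-th derivative is symmetric, so the order is immaterial. *)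
Section HigherDerivatives.
Variables (R : realType) (Q W : normedModType R) (f : Q -> W).

Definition fderiv2 := fderiv (fderiv f).
Definition fderiv3 := fderiv fderiv2.
Definition fderiv4 := fderiv fderiv3.

End HigherDerivatives.

Definition local_minimizer (R : realType) (Q : normedModType R) (j : Q -> R)
    (q : Q) : Prop :=
  \forall q' \near q, j q <= j q'.

Definition control_to_state (R : realType) (U Q V : normedModType R)
    (A : U * Q -> blin V R) (S : Q -> U) : Prop :=
  forall q, A (S q, q) = 0.

Definition reduced (R : realType) (U Q : normedModType R) (S : Q -> U)
    (J : U * Q -> R) (q : Q) : R :=
  J (S q, q).

Section ErrorRepresentation.
Variables (R : realType) (Q : normedModType R) (j i : Q -> R).

Definition reduced_adjoint (q p : Q) : Prop :=
  forall dq : Q, fderiv2 j q dq p = - fderiv i q dq.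

Definition rho (qh dq : Q) : R := fderiv j qh dq.

Definition rho_star (qh ph dq : Q) : R :=
  fderiv i qh dq + fderiv2 j qh dq ph.

Definition remainder3 (q p qh ph : Q) : R :=
  let e := q - qh in
  let es := p - ph in
  2^-1 * \int[lebesgue_measure]_(s in `[0%R, 1%R])
    ((fderiv3 i (qh + s *: e) e e e
      + fderiv4 j (qh + s *: e) e e e (ph + s *: es)
      + 3 * fderiv3 j (qh + s *: e) e e es) * (s * (s - 1))).

End ErrorRepresentation.

(* Main.v *)
(* Along the segment x(s) = qh + s e, p(s) = ph + s e*, the Lagrangian
   L(s) = i(x(s)) + j'(x(s))(p(s)) satisfies L(1) = i(qbar), since j'(qbar) = 0,
   and L'(1) = 0, by the adjoint equation. The claim is the error formula
   L(1) - L(0) = (L'(0) + L'(1)) / 2 + 1/2 int_0^1 L'''(s) s (s - 1) ds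
   of the trapezoidal rule. Differentiating L in s always adds e as the outermost
   direction, so the symmetry of higher derivatives plays no role. *)
Require Import Defs.
From HB Require Import structures.
From mathcomp Require Import all_boot all_order all_algebra.
From mathcomp Require Import all_classical all_reals all_analysis.
From mathcomp Require Import ring.
Import Order.TTheory GRing.Theory Num.Theory.
Import numFieldNormedType.Exports.
Local Open Scope classical_set_scope.
Local Open Scope ring_scope.

(** Named so that evaluation at [d] can carry a linear structure: iterated derivatives are nested
    operators, and each of their arguments is fixed by one such evaluation. *)
Definition blin_eval {R : realType} {V W : normedModType R} (d : V)
  (f : blin V W) : W := f d.

Fact blin_eval_linear (R : realType) (V W : normedModType R) (d : V) :
  linear (@blin_eval R V W d).
Proof. by []. Qed.

HB.instance Definition _ (R : realType) (V W : normedModType R) (d : V) :=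
  GRing.isLinear.Build R (blin V W) W *:%R (@blin_eval R V W d)
    (@blin_eval_linear R V W d).

(** By [le_opnorm], any constant that is at least the norm of [d] bounds this evaluation. *)
Lemma blin_eval_continuous (R : realType) (V W : normedModType R) (d : V) :
  continuous (@blin_eval R V W d).
Proof.
apply/linear_bounded_continuous/linear_boundedP; near=> r => f.
apply: (le_trans (le_opnorm f d)); rewrite mulrC; apply: ler_wpM2r.
  exact: opnorm_ge0.
by near: r; apply: nbhs_pinfty_ge; rewrite num_real.
Unshelve. all: by end_near. Qed.

(** Evaluation at [d] is continuous and linear, hence its own differential, and the chain rule
    applies. *)
Lemma is_derive_blin_eval (R : realType) (V W : normedModType R)
    (B : R -> blin V W) (B' : blin V W) (s : R) (d : V) :
  is_derive s 1 B B' -> is_derive s 1 (fun t => B t d) (B' d).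
Proof.
move=> [/derivable1_diffP dB <-].
have dev : is_diff (B s) (@blin_eval R V W d) (@blin_eval R V W d).
  apply: DiffDef; first exact/linear_differentiable/blin_eval_continuous.
  exact/diff_lin/blin_eval_continuous.
have dc : is_diff s (fun t => B t d) (@blin_eval R V W d \o 'd B s).
  exact: (@is_diff_comp _ _ _ _ B _ (@blin_eval R V W d)).
apply: DeriveDef; first exact/derivable1_diffP.
by rewrite !deriveE// diff_val.
Qed.

Lemma is_derive_fderiv_line (R : realType) (V W : normedModType R)
    (f : V -> W) (x e : V) (s : R) : differentiable f (x + s *: e) ->
  is_derive s 1 (fun t : R => f (x + t *: e)) (fderiv f (x + s *: e) e).
Proof.
move=> df.
have dl : is_diff s (fun t : R => x + t *: e) ( *:%R^~ e).
  have := is_diffD (is_diff_cst x s) (is_diff_scalel s e).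
  by rewrite add0r.
have dc : is_diff s (fun t : R => f (x + t *: e))
    ('d f (x + s *: e) \o *:%R^~ e).
  exact: (@is_diff_comp _ _ _ _ (fun t : R => x + t *: e) _ f).
apply: DeriveDef; first by apply/derivable1_diffP.
by rewrite deriveE// diff_val/= scale1r fderivE.
Qed.

(** Fermat's rule in one variable: along the line through [q] in direction [d], the parameter 0 is a
    minimum over a small open interval. *)
Lemma fderiv_local_minimizer (R : realType) (Q : normedModType R) (j : Q -> R)
    (q d : Q) : (forall x, differentiable j x) -> local_minimizer j q ->
  fderiv j q d = 0.
Proof.
move=> dj jq.
have dl (s : R) : is_derive s 1 (fun t : R => j (q + t *: d)) (fderiv j (q + s *: d) d).
  exact: is_derive_fderiv_line.
have lineq : (fun t : R => q + t *: d) @ (0 : R) --> q.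
  rewrite -[X in _ --> X]addr0 -(scale0r d).
  by apply: cvgD; [exact: cvg_cst|exact: scalel_continuous].
have /lineq/nbhs_ballP[r /= r0 jr] := jq.
have := @derive1_at_min R (fun t : R => j (q + t *: d)) (- r) r 0.
case.
- by rewrite lerNl (le_trans _ (ltW r0))// oppr_le0 ltW.
- by move=> t _; have [] := dl t.
- by rewrite in_itv/= oppr_lt0 r0.
- move=> t; rewrite in_itv/= => rt; rewrite scale0r addr0; apply: jr => /=.
  by rewrite /ball/= sub0r normrN ltr_norml.
by move=> _ <-; have [_] := dl 0; rewrite scale0r addr0 => <-.
Qed.

(** Integrating by parts twice moves the derivatives onto the weight s(s - 1), whose second
    derivative is the constant 2. *)
Lemma trapezoidal_error (R : realType) (g g1 g2 g3 : R -> R) :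
  (forall s : R, is_derive s 1 g (g1 s)) -> (forall s : R, is_derive s 1 g1 (g2 s)) ->
  (forall s : R, is_derive s 1 g2 (g3 s)) -> continuous g3 ->
  g 1 - g 0 = 2^-1 * (g1 0 + g1 1)
    + 2^-1 * \int[lebesgue_measure]_(s in `[0, 1]) (g3 s * (s * (s - 1))).
Proof.
move=> dg dg1 dg2 cg3.
(* An antiderivative of the integrand: the factors are s(s - 1) and its derivatives 2s - 1 and 2.
   The weight vanishes at 0 and 1, so [g2] drops out of [G 1 - G 0], while 2s - 1 takes the values
   -1 and 1 there. *)
pose G : R -> R := g2 * (id * (id - cst 1)) - g1 * (id + id - cst 1) + (g + g).
have dG (s : R) : is_derive s 1 G (g3 s * (s * (s - 1))).
  have did := is_derive_id s (1 : R); have d1 := is_derive_cst (1 : R) s (1 : R).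
  apply: (is_derive_eq (is_deriveD (is_deriveB
    (is_deriveM (dg2 s) (is_deriveM did (is_deriveB did d1)))
    (is_deriveM (dg1 s) (is_deriveB (is_deriveD did did) d1)))
    (is_deriveD (dg s) (dg s)))).
  rewrite /GRing.scale/= !fctE /=; ring.
have cG : continuous G.
  by move=> s; apply/differentiable_continuous/derivable1_diffP; have [] := dG s.
rewrite /Rintegral (@continuous_FTC2 _ _ G)//.
- by rewrite -EFinB/= /G !fctE/=; field.
- apply: continuous_subspaceT => s; apply: cvgM; first exact: cg3.
  by apply: cvgM; [exact: cvg_id|apply: cvgB; [exact: cvg_id|exact: cvg_cst]].
- split; first by move=> s _; have [] := dG s.
  + exact/cvg_at_right_filter/cG.
  + exact/cvg_at_left_filter/cG.
- by move=> s _; rewrite derive1E; have [] := dG s.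
Qed.

Theorem theorem3p1 (R : realType) (U Q V : completeNormedModType R)
  (J : U * Q -> R) (A : U * Q -> blin V R) (I : U * Q -> R) (S : Q -> U)
  (S_unique : unique (control_to_state A) S)
  (S_C2 : is_Cn 2 S)
  (j_C4 : is_Cn 4 (reduced S J))
  (i_C3 : is_Cn 3 (reduced S I))
  (qbar : Q) (qbar_min : local_minimizer (reduced S J) qbar)
  (pbar : Q)
  (pbar_adjoint : unique (reduced_adjoint (reduced S J) (reduced S I) qbar) pbar)
  (qh ph : Q) :
  let j := reduced S J in
  let i := reduced S I in
  i qbar - i qh =
    2^-1 * rho j qh (pbar - ph) + 2^-1 * rho_star j i qh ph (qbar - qh)
    + rho j qh ph + remainder3 j i qbar pbar qh ph.
Proof.
move=> j i; rewrite -/j -/i in j_C4 i_C3 qbar_min pbar_adjoint.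
case: j_C4 => dj [dj1 [dj2 [dj3 cj4]]]; case: i_C3 => di [di1 [di2 ci3]].
have adj dq : fderiv2 j qbar dq pbar = - fderiv i qbar dq.
  by have [] := pbar_adjoint.
rewrite /remainder3 /rho /rho_star.
set e := qbar - qh; set es := pbar - ph.
pose x (s : R) := qh + s *: e; pose p (s : R) := ph + s *: es.
have x1 : x 1 = qbar by rewrite /x scale1r addrC subrK.
have x0 : x 0 = qh by rewrite /x scale0r addr0.
have p1 : p 1 = pbar by rewrite /p scale1r addrC subrK.
have p0 : p 0 = ph by rewrite /p scale0r addr0.
have j'0 d : fderiv j qbar d = 0 by exact: fderiv_local_minimizer.
(* Since [p] is affine, the moving argument is traded for the two fixed ones [ph] and [es]. *)
have pE (B : blin Q R) s : B (p s) = B ph + s * B es.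
  by rewrite linearD linearZ.
pose L (s : R) := i (x s) + fderiv j (x s) (p s).
(* The factors 2 and 3 below count the terms in which exactly one differentiation falls on [p]; as
   [p] is affine with slope [es], two such differentiations give 0. *)
pose L1 (s : R) := fderiv i (x s) e + fderiv2 j (x s) e (p s) + fderiv j (x s) es.
pose L2 (s : R) := fderiv2 i (x s) e e + fderiv3 j (x s) e e (p s)
  + 2 * fderiv2 j (x s) e es.
pose L3 (s : R) := fderiv3 i (x s) e e e + fderiv4 j (x s) e e e (p s)
  + 3 * fderiv3 j (x s) e e es.
have dB (B : R -> blin Q R) (B' : blin Q R) (s : R) : is_derive s 1 B B' ->
    is_derive s 1 (fun t => B t (p t)) (B' (p s) + B s es).
  move=> dBs.
  have := is_derive_blin_eval _ _ _ _ _ _ ph dBs.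
  have := is_derive_blin_eval _ _ _ _ _ _ es dBs.
  move=> d2 d1.
  have -> : (fun t => B t (p t)) = (fun t => B t ph) + id * (fun t => B t es).
    by apply/funext => t; rewrite pE.
  apply: (is_derive_eq (is_deriveD d1 (is_deriveM (is_derive_id s 1) d2))).
  by rewrite pE /GRing.scale/=; ring.
have dx (W : normedModType R) (f : Q -> W) (s : R) : (forall y, differentiable f y) ->
    is_derive s 1 (f \o x) (fderiv f (x s) e).
  by move=> df; exact: is_derive_fderiv_line.
have cx : continuous x.
  by move=> s; apply: cvgD; [exact: cvg_cst|exact: scalel_continuous].
have cev (W : normedModType R) (B : R -> blin Q W) d :
    continuous B -> continuous (fun s => B s d).
  move=> cB s; apply: (@continuous_comp _ _ _ B (@blin_eval R Q W d)).
    exact: cB.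
  exact: blin_eval_continuous.
have dL (s : R) : is_derive s 1 L (L1 s).
  have h1 := dx _ _ s di; have h2 := dB _ _ _ (dx _ _ s dj1).
  rewrite /L1 -addrA; exact: is_deriveD.
(* The chain rule along [x] supplies the outermost [e]; evaluations then fill the inner slots from
   the outside in, and [dB] handles a last slot that moves with [p]. *)
have dL1 (s : R) : is_derive s 1 L1 (L2 s).
  have h1 := is_derive_blin_eval _ _ _ _ _ _ e (dx _ _ s di1).
  have h2 := dB _ _ _ (is_derive_blin_eval _ _ _ _ _ _ e (dx _ _ s dj2)).
  have h3 := is_derive_blin_eval _ _ _ _ _ _ es (dx _ _ s dj1).
  apply: (is_derive_eq (is_deriveD (is_deriveD h1 h2) h3)).
  rewrite /L2 /fderiv2 /fderiv3/=; ring.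
have dL2 (s : R) : is_derive s 1 L2 (L3 s).
  have ev2 := is_derive_blin_eval.
  have h1 := ev2 _ _ _ _ _ _ e (ev2 _ _ _ _ _ _ e (dx _ _ s di2)).
  have h2 := dB _ _ _ (ev2 _ _ _ _ _ _ e (ev2 _ _ _ _ _ _ e (dx _ _ s dj3))).
  have h3 := ev2 _ _ _ _ _ _ es (ev2 _ _ _ _ _ _ e (dx _ _ s dj2)).
  apply: (is_derive_eq (is_deriveD (is_deriveD h1 h2) (is_deriveZ 2 h3))).
  rewrite /L3 /fderiv4 /fderiv3 /fderiv2 /GRing.scale/=; ring.
have cL3 : continuous L3.
  have ci s : {for s, continuous (fderiv3 i \o x)}.
    by apply: continuous_comp; [exact: cx|exact: ci3].
  have cj s : {for s, continuous (fderiv4 j \o x)}.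
    by apply: continuous_comp; [exact: cx|exact: cj4].
  (* Being differentiable, the third derivative of [j] is continuous. *)
  have cj3 s : {for s, continuous (fderiv3 j \o x)}.
    by apply: continuous_comp; [exact: cx|exact/differentiable_continuous].
  have cp (B : R -> blin Q R) : continuous B -> continuous (fun s => B s (p s)).
    move=> cB; have -> : (fun s => B s (p s)) = (fun s => B s ph + s * B s es).
      by apply/funext => s; rewrite pE.
    move=> s; apply: cvgD; first exact: cev.
    by apply: cvgM; [exact: cvg_id|exact: cev].
  move=> s; apply: cvgD; first apply: cvgD.
  - exact: (cev _ _ _ (cev _ _ _ (cev _ _ _ ci))).
  - exact: (cp _ (cev _ _ _ (cev _ _ _ (cev _ _ _ cj)))).
  - apply: cvgM; first exact: cvg_cst.
    exact: (cev _ _ _ (cev _ _ _ (cev _ _ _ cj3))).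
have := trapezoidal_error _ _ _ _ _ dL dL1 dL2 cL3.
have -> : L 1 = i qbar by rewrite /L x1 j'0 addr0.
(* The second summand of [L 0] is the source of the separate term [rho j qh ph] in the claim. *)
have -> : L 0 = i qh + fderiv j qh ph by rewrite /L x0 p0.
(* Stationarity of [j] at [qbar] removes the [es] term, and the adjoint equation in direction [e]
   cancels the other two. *)
have -> : L1 1 = 0.
  by rewrite /L1 x1 p1 [X in _ + X]j'0 addr0 [X in _ + X]adj subrr.
have -> : L1 0 = fderiv i qh e + fderiv2 j qh e ph + fderiv j qh es.
  by rewrite /L1 x0 p0.
rewrite addr0 => /eqP; rewrite opprD addrA subr_eq => /eqP ->.
by rewrite addrAC [2^-1 * (_ + fderiv j qh es)]mulrDr [2^-1 * _ + 2^-1 * _]addrC.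
Qed.
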